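(* a) Let $b\ge 4$ be an even integer with $b\equiv 1\pmod{3}$, and let $k\ge 1$ be an integer with $k\equiv 1\pmod{3}$. Define $\alpha_k=[1(0)^{\wedge k}(b-2)]_b$, i.e. the integer whose base $b$ digits are $1$, followed by $k$ zeros, followed by the digit $b-2$. Then $N_k=\alpha_k\cdot(\alpha_k)^R$ is a $b$-MRH number. b) Let $b=2$ and let $k\ge 1$ be an even integer. Define $\alpha_k=[1(0)^{\wedge k}1]_2$, i.e. the integer whose base $2$ digits are $1$, followed by $k$ zeros, followed by $1$. Then $N_k=\alpha_k\cdot(\alpha_k)^R$ is a $b$-MRH number (with $b=2$).
   Context: Let $b\ge 2$ be a numeration base. For a string $x$ of base $b$ digits, $(x)^{\wedge k}$ is the string obtained by repeating $x$ $k$ times, and $[x]_b$ is the integer represented by the string $x$ in base $b$. $s_b(N)$ is the sum of the base $b$ digits of $N$. The reversal $N^R$ of a nonnegative integer $N$ is the integer obtained by writing the base $b$ digits of $N$ (without leading zeros) in reverse order, i.e. if $N=\sum_{i=0}^{d-1} n_i b^i$ with $0\le n_i<b$, $n_{d-1}\neq 0$, then $N^R=\sum_{i=0}^{d-1} n_i b^{d-1-i}$ (and $0^R=0$). A positive integer $N$ is a $b$-MRH ($b$-multiplicative Ramanujan-Hardy) number if there is a nonnegative integer $M$ (a multiplicative multiplier) such that $N=(s_b(N)M)\cdot(s_b(N)M)^R$. *)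

(* Defs.v *)
From mathcomp Require Import all_boot.

Set Implicit Arguments.
Unset Strict Implicit.
Unset Printing Implicit Defensive.

(* In all definitions below, b is a numeration base and is meant to satisfy
   2 <= b. *)

(* Strings of digits are sequences with the most significant digit first. *)
Definition str_repeat (x : seq nat) (k : nat) : seq nat := flatten (nseq k x).

Definition str_value (b : nat) (x : seq nat) : nat :=
  foldl (fun v d => v * b + d) 0 x.

(* Unlike in strings, index 0 is the least significant digit. *)
Definition digit (b N i : nat) : nat := (N %/ b ^ i) %% b.

(* Number of base b digits without leading zeros; 0 has the empty expansion. *)
Definition ndigits (b N : nat) : nat :=
  if N == 0 then 0 else (trunc_log b N).+1.

Definition digit_sum (b N : nat) : nat := \sum_(i < ndigits b N) digit b N i.

Definition reversal (b N : nat) : nat :=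
  \sum_(i < ndigits b N) digit b N i * b ^ ((ndigits b N).-1 - i).

Definition MRH (b N : nat) : Prop :=
  0 < N /\
  exists M : nat, N = (digit_sum b N * M) * reversal b (digit_sum b N * M).

(* Main.v *)
Require Import Defs.
From mathcomp Require Import all_boot zify.

Set Implicit Arguments.
Unset Strict Implicit.
Unset Printing Implicit Defensive.

(** Let [B = b ^ k.+1].  In both parts alpha has the form [B + d] with a last
    digit [d] ([d = b - 2], resp. [d = 1]), its reversal is [d * B + 1], and
    so [N = d * B ^ 2 + (d ^ 2 + 1) * B + d].  Since [d < b], the middle
    coefficient is a two-digit number [u * b + v]; as [k > 0], its two digits
    do not overlap the leading [d], so the digit sum of [N] is
    [2 * d + u + v], whatever [k] is.  As soon as this digit sum divides
    alpha, writing alpha as digit sum times [M] exhibits [N] as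
    an MRH number ([MRH_two_digit_product]).

    It remains to find the middle digits and to check the divisibility.
    - For [b >= 6] and [d = b - 2], one has [d ^ 2 + 1 = (b - 4) * b + 5], so
      the digit sum is [3 * (b - 1)].  Now alpha equals
      [b - 1] times [1 + b ^ 0 + ... + b ^ k], and the second factor is
      congruent to [k + 2], that is to 0, modulo 3.
    - For [b = 4] the digit 5 is too large: the middle digits are [1, 1] and
      the digit sum is 6, which divides alpha by the same congruence and
      parity.
    - For [b = 2] and [d = 1] the middle digits are [1, 0] and the digit sum is
      3, which divides [2 ^ k.+1 + 1] because [k.+1] is odd.

    Digit sums and reversals are computed by appending one digit at a time on
    the right, that is by passing from [q] to [q * b + r]. *)

Section AppendDigit.

Variables (b : nat) (b_gt1 : 1 < b).

Lemma digit_append0 q r : r < b -> digit b (q * b + r) 0 = r.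
Proof. by move=> ltrb; rewrite /digit expn0 divn1 modnMDl modn_small. Qed.

Lemma digit_appendS q r i : r < b -> digit b (q * b + r) i.+1 = digit b q i.
Proof.
move=> ltrb; rewrite /digit expnS divnMA divnMDl ?(ltnW b_gt1) //.
by rewrite (divn_small ltrb) addn0.
Qed.

(** The positivity hypothesis allows [q = 0] with a nonzero digit, so that
    one-digit numbers are covered; only [0], which has no digit at all, escapes
    the rule. *)
Lemma ndigits_append q r :
  r < b -> 0 < q * b + r -> ndigits b (q * b + r) = (ndigits b q).+1.
Proof.
move=> ltrb N_gt0; rewrite /ndigits (gtn_eqF N_gt0).
congr _.+1; case: posnP => [->|q_gt0].
  by rewrite mul0n add0n /=; apply/eqP; rewrite trunc_log_eq0; lia.
have /andP[leq ltq] := trunc_log_bounds b_gt1 q_gt0.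
apply: trunc_log_eq => //; rewrite !expnS in ltq *; nia.
Qed.

Lemma digit_sum_append q r :
  r < b -> 0 < q * b + r -> digit_sum b (q * b + r) = digit_sum b q + r.
Proof.
move=> ltrb N_gt0; rewrite /digit_sum ndigits_append // big_ord_recl addnC.
by rewrite digit_append0 //; congr (_ + _); apply: eq_bigr => i _; rewrite digit_appendS.
Qed.

(** The last digit of a number is the first one of its reversal, where it
    stands in front of as many digits as the rest of the number has. *)
Lemma reversal_append q r :
  r < b -> 0 < q * b + r ->
  reversal b (q * b + r) = r * b ^ ndigits b q + reversal b q.
Proof.
move=> ltrb N_gt0; rewrite /reversal ndigits_append // big_ord_recl /= subn0.
rewrite digit_append0 //; congr (_ + _); apply: eq_bigr => i _.
by rewrite digit_appendS // subnS predn_sub.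
Qed.

Lemma digit_sum0 : digit_sum b 0 = 0. Proof. by rewrite /digit_sum big_ord0. Qed.

Lemma reversal0 : reversal b 0 = 0. Proof. by rewrite /reversal big_ord0. Qed.

Lemma ndigits1 : ndigits b 1 = 1.
Proof. by rewrite -[1 in LHS]/(0 * b + 1) ndigits_append. Qed.

Lemma reversal1 : reversal b 1 = 1.
Proof. by rewrite -[1 in LHS]/(0 * b + 1) reversal_append // reversal0. Qed.

Lemma digit_sum_digit d : d < b -> digit_sum b d = d.
Proof.
have [->|d_gt0] := posnP d; first by rewrite digit_sum0.
by move=> ltdb; rewrite -[d in LHS]/(0 * b + d) digit_sum_append // digit_sum0.
Qed.

Lemma mul_expn_append0 q n : q * b ^ n.+1 = (q * b ^ n) * b + 0.
Proof. by rewrite addn0 expnSr mulnA. Qed.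

Lemma ndigits_shift q n : 0 < q -> ndigits b (q * b ^ n) = n + ndigits b q.
Proof.
move=> q_gt0; elim: n => [|n IHn]; first by rewrite muln1.
by rewrite mul_expn_append0 ndigits_append ?IHn; nia.
Qed.

Lemma digit_sum_shift q n : 0 < q -> digit_sum b (q * b ^ n) = digit_sum b q.
Proof.
move=> q_gt0; elim: n => [|n IHn]; first by rewrite muln1.
have b_gt0 := ltnW b_gt1; have bn_gt0 : 0 < b ^ n by rewrite expn_gt0 b_gt0.
by rewrite mul_expn_append0 digit_sum_append ?IHn ?addn0 // !muln_gt0 q_gt0 bn_gt0.
Qed.

Lemma reversal_shift q n : 0 < q -> reversal b (q * b ^ n) = reversal b q.
Proof.
move=> q_gt0; elim: n => [|n IHn]; first by rewrite muln1.
have b_gt0 := ltnW b_gt1; have bn_gt0 : 0 < b ^ n by rewrite expn_gt0 b_gt0.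
by rewrite mul_expn_append0 reversal_append ?IHn ?addn0 // !muln_gt0 q_gt0 bn_gt0.
Qed.

Lemma str_value_two_digits k d :
  str_value b ([:: 1] ++ str_repeat [:: 0] k ++ [:: d]) = b ^ k.+1 + d.
Proof.
rewrite /str_value /str_repeat /= mul0n add0n foldl_cat /= expnSr.
suff zeros v :
    foldl (fun w e => w * b + e) v (flatten (nseq k [:: 0])) = v * b ^ k.
  by rewrite zeros mul1n.
elim: k v => [|k IHk] v /=; first by rewrite muln1.
by rewrite IHk addn0 expnS mulnA.
Qed.

Lemma reversal_two_digits k d :
  d < b -> reversal b (b ^ k.+1 + d) = d * b ^ k.+1 + 1.
Proof.
move=> ltdb; have b_gt0 := ltnW b_gt1.
have bk_gt0 : 0 < b ^ k by rewrite expn_gt0 b_gt0.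
rewrite expnSr reversal_append //; last by rewrite addn_gt0 muln_gt0 bk_gt0 b_gt0.
have -> : ndigits b (b ^ k) = k.+1.
  by rewrite -[b ^ k]mul1n ndigits_shift // ndigits1 addn1.
have -> : reversal b (b ^ k) = 1.
  by rewrite -[b ^ k]mul1n reversal_shift // reversal1.
by rewrite expnSr.
Qed.

(** In the product of [b ^ k.+1 + d] with its reversal, the digits [d], [u],
    [v], [d] stand at the positions [2 * k + 2], [k + 2], [k + 1] and [0], all
    others being 0; here [k > 0] separates the first two. *)
Lemma digit_sum_two_digit_product k d u v :
  0 < k -> 0 < d < b -> u < b -> v < b -> d ^ 2 + 1 = u * b + v ->
  digit_sum b ((b ^ k.+1 + d) * (d * b ^ k.+1 + 1)) = d + u + v + d.
Proof.
case: k => [//|k] _ /andP[d_gt0 ltdb] ltub ltvb duv.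
have b_gt0 := ltnW b_gt1; have bk_gt0 n : 0 < b ^ n by rewrite expn_gt0 b_gt0.
have -> : (b ^ k.+2 + d) * (d * b ^ k.+2 + 1) =
    ((((d * b ^ k) * b + u) * b + v) * b ^ k.+1) * b + d.
  have -> : (b ^ k.+2 + d) * (d * b ^ k.+2 + 1) =
    d * b ^ k.+2 * b ^ k.+2 + (d ^ 2 + 1) * b ^ k.+2 + d by nia.
  by rewrite duv !expnSr; nia.
have dbk_gt0 : 0 < d * b ^ k by rewrite muln_gt0 d_gt0 bk_gt0.
have du_gt0 : 0 < d * b ^ k * b + u by rewrite addn_gt0 muln_gt0 dbk_gt0 b_gt0.
have duv_gt0 : 0 < (d * b ^ k * b + u) * b + v.
  by rewrite addn_gt0 muln_gt0 du_gt0 b_gt0.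
rewrite digit_sum_append // ?addn_gt0 ?d_gt0 ?orbT // digit_sum_shift //.
by rewrite !digit_sum_append // digit_sum_shift // digit_sum_digit.
Qed.

(** If the digit sum [s] of the product divides [b ^ k.+1 + d], the multiplier
    [M] is the quotient: then [s * M] is [b ^ k.+1 + d] again, and the given
    factorization is the required one. *)
Lemma MRH_two_digit_product k d u v :
  0 < k -> 0 < d < b -> u < b -> v < b -> d ^ 2 + 1 = u * b + v ->
  d + u + v + d %| b ^ k.+1 + d ->
  MRH b ((b ^ k.+1 + d) * reversal b (b ^ k.+1 + d)).
Proof.
move=> k_gt0 db ltub ltvb duv /dvdnP[M defM]; have /andP[d_gt0 ltdb] := db.
split.
  by rewrite reversal_two_digits // muln_gt0 !addn_gt0 d_gt0 !orbT.
exists M; rewrite [in digit_sum _ _]reversal_two_digits //.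
by rewrite (digit_sum_two_digit_product k_gt0 db ltub ltvb duv) [_ * M]mulnC -defM.
Qed.

End AppendDigit.

(** Modulo [m], all powers of [b] are 1, so the [n] terms add up to [n]. *)
Lemma modn_geometric_sum m b n :
  b = 1 %[mod m] -> \sum_(i < n) b ^ i = n %[mod m].
Proof.
move=> b1; elim: n => [|n IHn]; first by rewrite big_ord0.
by rewrite big_ord_recr /= -modnDm IHn -modnXm b1 modnXm exp1n modnDm addn1.
Qed.

(** The number is [b ^ k.+1 - 1] plus [b - 1]; dividing it by [b - 1] leaves
    a geometric sum plus 1, which is [k + 2] modulo 3. *)
Lemma dvdn_expn_add_sub2 b k :
  2 <= b -> b = 1 %[mod 3] -> k = 1 %[mod 3] ->
  3 * (b - 1) %| b ^ k.+1 + (b - 2).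
Proof.
move=> b_ge2 b1 k1; have bk_gt0 : 0 < b ^ k.+1 by rewrite expn_gt0; lia.
have -> : b ^ k.+1 + (b - 2) = (\sum_(i < k.+1) b ^ i + 1) * (b - 1).
  by rewrite mulnDl mul1n mulnC subn1 -predn_exp; lia.
apply: dvdn_mul => //; rewrite /dvdn -modnDml modn_geometric_sum // modnDml.
by rewrite addn1 -(addn2 k) -modnDml k1.
Qed.

Theorem theorem5 :
  (forall b k : nat,
     4 <= b -> ~~ odd b -> b = 1 %[mod 3] ->
     1 <= k -> k = 1 %[mod 3] ->
     let alpha := str_value b ([:: 1] ++ str_repeat [:: 0] k ++ [:: b - 2]) in
     MRH b (alpha * reversal b alpha))
  /\
  (forall k : nat,
     1 <= k -> ~~ odd k ->
     let alpha := str_value 2 ([:: 1] ++ str_repeat [:: 0] k ++ [:: 1]) in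
     MRH 2 (alpha * reversal 2 alpha)).
Proof.
split=> [b k b_ge4 b_even b1 k_gt0 k1 alpha | k k_gt0 k_even alpha].
- rewrite /alpha str_value_two_digits.
  have b_gt1 : 1 < b by lia.
  have dvd_alpha := dvdn_expn_add_sub2 b_gt1 b1 k1.
  have [b_eq4|b_neq4] := eqVneq b 4.
    rewrite b_eq4 in dvd_alpha *.
    apply: (@MRH_two_digit_product 4 _ k 2 1 1) => //.
    rewrite -[2 + 1 + 1 + 2]/(2 * 3) Gauss_dvd // dvdn2 oddD oddX /=.
    exact: dvdn_trans dvd_alpha.
  have b_ge6 : 6 <= b by lia.
  apply: (@MRH_two_digit_product b _ k (b - 2) (b - 4) 5); try lia.
  by have -> : b - 2 + (b - 4) + 5 + (b - 2) = 3 * (b - 1) by lia.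
- rewrite /alpha str_value_two_digits.
  apply: (@MRH_two_digit_product 2 _ k 1 1 0) => //.
  (* With [k = 2 * m], this is [2 * 4 ^ m + 1], and 4 is 1 modulo 3. *)
  rewrite -(odd_double_half k) (negbTE k_even) add0n expnS -mul2n expnM.
  by rewrite /dvdn -modnDml -modnMmr -modnXm exp1n.
Qed.
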